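(* Let $a>b>0$, let $\mathcal{E}:\ \frac{\mathsf{x}^2}{a}+\frac{\mathsf{y}^2}{b}=1$, let $\mathcal{C}_{\lambda_0}$, $\lambda_0\in(0,b)\cup(b,a)$, be a conic confocal with $\mathcal{E}$, and let $k\ge1$ be an integer. Suppose that the billiard trajectories within $\mathcal{E}$ with caustic $\mathcal{C}_{\lambda_0}$ are periodic with period $4k$ and winding numbers $(4k,2k)$, and let $\hat p_{4k}$ be the corresponding polynomial. Then, up to a nonessential constant factor, $\hat p_{4k}(s)$ is equal to $$T_{2k}\!\left(2abs^2-2(a+b)s+1\right)$$ if the caustic is an ellipse, and to $$T_{2k}\!\left(\frac{a^2s^2-4a^2bs+8b^3(a-b)}{8b^3(a-b)}\right)$$ if the caustic is a hyperbola, where $T_{2k}$ is the $2k$-th Chebyshev polynomial.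
   Context: The confocal family is $\mathcal{C}_{\lambda}:\ \frac{\mathsf{x}^2}{a-\lambda}+\frac{\mathsf{y}^2}{b-\lambda}=1$; $\mathcal{C}_\lambda$ is an ellipse for $\lambda<b$ and a hyperbola for $\lambda\in(b,a)$. Billiard trajectories within $\mathcal{E}$ are polygonal lines with vertices on $\mathcal{E}$ obeying the reflection law; a trajectory has caustic $\mathcal{C}_{\lambda_0}$ if all lines containing its segments are tangent to $\mathcal{C}_{\lambda_0}$. A trajectory has period $n$ if it closes after $n$ reflections ($n$ not required to be minimal). Winding numbers $(m_0,m_1)$ of a periodic trajectory: $m_0$ is the number of reflection points and $m_1$ the number of intersections with the $\mathsf{y}$-axis along the period. The polynomial corresponding to $n$-periodic trajectories is a real polynomial $\hat p_n$ of degree $n$ for which there is a real polynomial $\hat q_{n-2}$ of degree $n-2$ with $\hat p_n^2(s)-s(s-\frac1a)(s-\frac1b)(s-\frac1{\lambda_0})\hat q_{n-2}^2(s)=1$. $T_j$ is the Chebyshev polynomial, $T_j(\cos\phi)=\cos j\phi$.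
   Formalization: In the hyperbola case the printed formula is false unless b = 1/2 (e.g. a=3, b=1, λ0=3/2, k=1); the formal statement evaluates the printed quadratic at 4b²s instead of s, giving T_{2k}((2a²bs² − 2a²s + a − b)/(a − b)). *)

(* Defs.v *)
From HB Require Import structures.
From mathcomp Require Import all_boot all_order all_algebra.
From mathcomp Require Import all_classical all_reals all_analysis.
From mathcomp Require Import ring.

Set Implicit Arguments.
Unset Strict Implicit.
Unset Printing Implicit Defensive.

Import Order.TTheory GRing.Theory Num.Theory.
Import numFieldNormedType.Exports.

Local Open Scope classical_set_scope.
Local Open Scope card_scope.
Local Open Scope ring_scope.

Section Billiard.
Context {R : realType}.
Implicit Types (a b lam : R) (A B : R * R) (P : nat -> R * R).

Definition on_conic a b lam A : Prop :=
  A.1 ^+ 2 / (a - lam) + A.2 ^+ 2 / (b - lam) = 1.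

(* Tangency is meant in the projective plane: (X : Y : Z) is a point of the
   conic and the line AB is its tangent line there. Z = 0 happens only for the
   asymptotes of a hyperbola, which do carry segments of trajectories having
   that hyperbola as caustic (the segments through the centre). *)
Definition tangent_line a b lam A B : Prop :=
  A <> B /\
  exists X Y Z : R,
    [/\ (X, Y, Z) <> (0, 0, 0),
        X ^+ 2 / (a - lam) + Y ^+ 2 / (b - lam) = Z ^+ 2,
        A.1 * X / (a - lam) + A.2 * Y / (b - lam) = Z &
        B.1 * X / (a - lam) + B.2 * Y / (b - lam) = Z].

(* Image of the vector v under the reflection in the tangent line of the
   ellipse x^2/a + y^2/b = 1 at A, whose normal is (A.1/a, A.2/b). *)
Definition reflect_dir a b A (v : R * R) : R * R :=
  let n := (A.1 / a, A.2 / b) in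
  let k := 2 * (v.1 * n.1 + v.2 * n.2) / (n.1 ^+ 2 + n.2 ^+ 2) in
  (v.1 - k * n.1, v.2 - k * n.2).

Definition reflection_law a b A B C : Prop :=
  let v := reflect_dir a b B (B.1 - A.1, B.2 - A.2) in
  exists2 mu : R, 0 < mu & (C.1 - B.1, C.2 - B.2) = (mu * v.1, mu * v.2).

Definition billiard_trajectory a b P : Prop :=
  [/\ forall i, on_conic a b 0 (P i),
      forall i, P i <> P i.+1 &
      forall i, reflection_law a b (P i) (P i.+1) (P i.+2)].

Definition has_caustic a b lam P : Prop :=
  forall i, tangent_line a b lam (P i) (P i.+1).

Definition periodic_trajectory P (n : nat) : Prop :=
  forall i, P (i + n)%N = P i.

(* Parameters (i, t) of the intersections with the y-axis along the first n
   segments; the segments are half-open so that a vertex lying on the axis is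
   counted once. *)
Definition yaxis_hits P (n : nat) : set ('I_n * R) :=
  [set u : 'I_n * R |
    0 <= u.2 < 1 /\ (1 - u.2) * (P u.1).1 + u.2 * (P u.1.+1).1 = 0].
Arguments yaxis_hits : clear implicits.

(* The reflection points along a period n are P 0, ..., P n.-1. *)
Definition winding_numbers P (n m0 m1 : nat) : Prop :=
  m0 = n /\ yaxis_hits P n #= `I_m1.

End Billiard.

(* p has degree n and q has degree n - 2. *)
Definition corresponding_poly {R : realType} (a b lam : R) (n : nat)
    (p : {poly R}) : Prop :=
  size p = n.+1 /\
  exists q : {poly R},
    (size q).+1 = n /\
    p ^+ 2 - 'X * ('X - a^-1%:P) * ('X - b^-1%:P) * ('X - lam^-1%:P) * q ^+ 2
      = 1.

Fixpoint chebyshev_poly (R : nzRingType) (j : nat) : {poly R} :=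
  match j with
  | 0 => 1
  | 1 => 'X
  | (j'.+1 as i).+1 => 2%:P * 'X * chebyshev_poly R i - chebyshev_poly R j'
  end.

Lemma chebyshev_poly_cos (R : realType) (j : nat) (phi : R) :
  (chebyshev_poly R j).[cos phi] = cos (j%:R * phi).
Proof.
suff: (chebyshev_poly R j).[cos phi] = cos (j%:R * phi) /\
      (chebyshev_poly R j.+1).[cos phi] = cos (j.+1%:R * phi) by case.
elim: j => [|j [IH1 IH2]].
  by rewrite /= hornerC hornerX mul0r cos0 mul1r.
split=> //.
have -> : chebyshev_poly R j.+2 = 2%:P * 'X * chebyshev_poly R j.+1 - chebyshev_poly R j by [].
rewrite !hornerE IH1 IH2.
have -> : j.+2%:R * phi = j.+1%:R * phi + phi.
  by rewrite -[in LHS]addn1 natrD mulrDl mul1r.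
have -> : j%:R * phi = j.+1%:R * phi - phi.
  by rewrite -[in RHS]addn1 natrD mulrDl mul1r addrK.
rewrite !cosD cosN sinN; ring.
Qed.

(* Main.v *)
(* The caustic is forced to be the one whose trajectories close after four
   bounces. Follow a trajectory started at (0, sqrt b). For an elliptic caustic
   det (P_i, P_(i+2)) has the sign of 1 / lambda0 - (1/a + 1/b), hence two
   consecutive chords always turn by less than pi, by exactly pi, or always by
   more than pi around the centre. If it is not exactly pi, counting the
   crossings of the y-axis two chords at a time gives fewer or more than 2k. For
   a hyperbolic caustic the same count works with P_i replaced by the pair
   (x_i, +- tangential velocity at P_i), and the threshold is 1/b - 1/a.
   Once 1 / lambda0 is known, the quadratic g of the statement satisfies
   g^2 - 1 = kap^2 s (s - 1/a) (s - 1/b) (s - 1/lambda0), so that T_2k o g solves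
   the Pell equation of p, and a polynomial solution of that equation is
   determined up to sign by its degree. *)

Require Import Defs.
From mathcomp Require Import all_boot all_order all_algebra finmap.
From mathcomp Require Import all_classical all_reals all_analysis.
From mathcomp Require Import ring lra zify.

Set Implicit Arguments.
Unset Strict Implicit.
Unset Printing Implicit Defensive.

Import Order.TTheory GRing.Theory Num.Theory.
Local Open Scope ring_scope.

(** * Chebyshev polynomials and the polynomial Pell equation *)

Lemma size_chebyshev_poly (R : realType) (j : nat) :
  size (chebyshev_poly R j) = j.+1.
Proof.
suff: size (chebyshev_poly R j) = j.+1 /\ size (chebyshev_poly R j.+1) = j.+2.
  by case.
elim: j => [|j [IH1 IH2]]; first by rewrite /= size_poly1 size_polyX.
split=> //.
have -> : chebyshev_poly R j.+2 =
  2%:P * 'X * chebyshev_poly R j.+1 - chebyshev_poly R j by [].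
have sz : size (2%:P * 'X * chebyshev_poly R j.+1) = j.+3.
  rewrite -mulrA mul_polyC size_scale ?pnatr_eq0 // mulrC size_mulX ?IH2 //.
  by rewrite -size_poly_eq0 IH2.
by rewrite size_polyDl sz // size_polyN IH1.
Qed.

Lemma chebyshev_poly_pell (R : realType) (j : nat) :
  exists u : {poly R}, chebyshev_poly R j ^+ 2 - ('X ^+ 2 - 1) * u ^+ 2 = 1.
Proof.
(* The second identity is the addition formula for the cosine and makes the induction close; [u] is
   the Chebyshev polynomial of the second kind. *)
suff: exists u : {poly R},
    chebyshev_poly R j ^+ 2 - ('X ^+ 2 - 1) * u ^+ 2 = 1 /\
    chebyshev_poly R j.+1 = 'X * chebyshev_poly R j + ('X ^+ 2 - 1) * u.
  by case=> u [? _]; exists u.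
elim: j => [|j [u [pell succ]]].
  by exists 0; rewrite expr0n /= !mulr0 expr1n subr0 mulr1 addr0.
exists ('X * u + chebyshev_poly R j); split.
  by rewrite succ -[RHS]pell; ring.
have -> : chebyshev_poly R j.+2 =
  2%:P * 'X * chebyshev_poly R j.+1 - chebyshev_poly R j by [].
by rewrite succ (_ : 2%:P = 2 :> {poly R}) ?polyC_natr //; ring.
Qed.

(* Two solutions are multiplied in Z[sqrt D]: (p P -+ D q Q, p Q -+ q P) are
   again solutions and the product of the two second components is
   [Q ^+ 2 - q ^+ 2], whose degree is too small unless one of them is 0. *)
Lemma pell_unique (R : realType) (D p q P Q : {poly R}) :
  (1 < size D)%N -> (1 < size p)%N -> size p = size P ->
  p ^+ 2 - D * q ^+ 2 = 1 -> P ^+ 2 - D * Q ^+ 2 = 1 -> p = P \/ p = - P.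
Proof.
move=> sD sp spP pell Pell.
have size_sqr (r : {poly R}) : r != 0 -> size (r ^+ 2) = (size r + size r)%N.-1.
  by move=> r0; rewrite expr2 size_mul.
have size_snd (r s : {poly R}) : (1 < size r)%N -> r ^+ 2 - D * s ^+ 2 = 1 ->
    s != 0 /\ (size D + size s + size s)%N = (size r + size r).+1%N.
  move=> sr rs; have r0 : r != 0 by rewrite -size_poly_gt0; lia.
  have Ds : D * s ^+ 2 = r ^+ 2 - 1 by rewrite -rs; ring.
  have szDs : size (D * s ^+ 2) = (size r + size r)%N.-1.
    by rewrite Ds size_polyDl size_sqr // size_polyN size_poly1; lia.
  have s0 : s != 0.
    apply/eqP => s0; move: szDs; rewrite s0 expr0n mulr0 size_poly0; lia.
  have D0 : D != 0 by rewrite -size_poly_gt0; lia.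
  split=> //; move: szDs; rewrite size_mul ?expf_neq0 // size_sqr //.
  move: s0 sD sr; rewrite -size_poly_gt0.
  by move: (size s) (size D) (size r) => x y z; lia.
have [q0 sq] := size_snd p q sp pell.
have [Q0 sQ] := size_snd P Q (eq_ind _ (fun n => is_true (1 < n)%N) sp _ spP) Pell.
have p0 : p != 0 by rewrite -size_poly_gt0; lia.
suff pQ : p * Q - q * P = 0 \/ p * Q + q * P = 0.
  have qQ : q ^+ 2 = Q ^+ 2.
    suff: Q ^+ 2 - q ^+ 2 = 0 by move/eqP; rewrite subr_eq0 => /eqP.
    have -> : Q ^+ 2 - q ^+ 2 = (p * Q - q * P) * (p * Q + q * P) +
        q ^+ 2 * (P ^+ 2 - D * Q ^+ 2 - 1) - Q ^+ 2 * (p ^+ 2 - D * q ^+ 2 - 1).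
      by ring.
    by rewrite pell Pell subrr !mulr0 subr0 addr0; case: pQ => ->; rewrite ?mul0r ?mulr0.
  have /eqP : p ^+ 2 = P ^+ 2.
    by apply: (addIr (- (D * q ^+ 2))); rewrite pell qQ Pell.
  by rewrite eqf_sqr => /orP[] /eqP ->; [left | right].
have [->|u0] := eqVneq (p * Q - q * P) 0; first by left.
have [->|v0] := eqVneq (p * Q + q * P) 0; first by right.
exfalso.
have uv : (p * Q - q * P) * (p * Q + q * P) = Q ^+ 2 - q ^+ 2.
  have -> : (p * Q - q * P) * (p * Q + q * P) = Q ^+ 2 - q ^+ 2 +
      Q ^+ 2 * (p ^+ 2 - D * q ^+ 2 - 1) - q ^+ 2 * (P ^+ 2 - D * Q ^+ 2 - 1).
    by ring.
  by rewrite pell Pell subrr !mulr0 subr0 addr0.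
have two0 : 2 != 0 :> R by rewrite pnatr_eq0.
(* One of the two nonzero factors has at least the degree of [p * Q], which exceeds that of [Q ^+ 2]
   because [D] is not constant. *)
have sum : 2 *: (p * Q) = (p * Q - q * P) + (p * Q + q * P).
  by rewrite -mul_polyC polyC_natr; ring.
have := size_polyD (p * Q - q * P) (p * Q + q * P).
rewrite -sum size_scale // size_mul // => big.
have := size_polyD (Q ^+ 2) (- q ^+ 2).
rewrite -uv size_mul // size_polyN !size_sqr // => small.
move: small big u0 v0 q0 Q0 sD sp sq sQ; rewrite -!size_poly_gt0 -spP.
move: (size (p * Q - q * P)) (size (p * Q + q * P)) => u v.
move: (size q) (size Q) (size D) (size p) => x y z t.
lia.
Qed.

(** If g is the polynomial being squared, g - 1 has the roots 0 and [e2], and the two hypotheses say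
    that g + 1 is [kap] times the product of X - [e3] and X - [e4]. *)
Lemma sqr_sub1_factor (R : realType) (kap e2 e3 e4 : R) :
  e2 = e3 + e4 -> kap * (e3 * e4) = 2 ->
  (kap%:P * ('X * ('X - e2%:P)) + 1) ^+ 2 - 1 =
  kap%:P ^+ 2 * ('X * ('X - e2%:P) * ('X - e3%:P) * ('X - e4%:P)).
Proof.
move=> -> prod.
have prodP : kap%:P * (e3%:P * e4%:P) = 2 :> {poly R}.
  by rewrite -!polyCM prod polyC_natr.
have -> : forall g : {poly R}, g ^+ 2 - 1 = (g - 1) * (g - 1 + 2) by move=> g; ring.
by rewrite -prodP polyCD; ring.
Qed.

(** Composing the Chebyshev solution with [g] solves the Pell equation of [p] in the same degree 4k,
    so uniqueness leaves only c = 1 and c = -1. *)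
Lemma corresponding_poly_chebyshev (R : realType) (a b lam kap e2 e3 e4 : R)
    (k : nat) (p : {poly R}) :
  (0 < k)%N -> kap != 0 -> e2 = e3 + e4 -> kap * (e3 * e4) = 2 ->
  'X * ('X - a^-1%:P) * ('X - b^-1%:P) * ('X - lam^-1%:P) =
    'X * ('X - e2%:P) * ('X - e3%:P) * ('X - e4%:P) ->
  corresponding_poly a b lam (4 * k) p ->
  exists2 c : R, c != 0 & forall s : R,
    p.[s] = c * (chebyshev_poly R (2 * k)).[kap * (s * (s - e2)) + 1].
Proof.
move=> k0 kap0 sum prod eD [sp [q [_ pell]]]; rewrite {}eD in pell.
set g := kap%:P * ('X * ('X - e2%:P)) + 1.
have sg : size g = 3%N.
  rewrite size_polyDl mul_polyC size_scale // size_mul ?polyX_eq0 ?polyXsubC_eq0 //;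
    by rewrite size_polyX size_XsubC ?size_poly1.
have gs s : g.[s] = kap * (s * (s - e2)) + 1 by rewrite !hornerE.
have [u Tu] := chebyshev_poly_pell R (2 * k).
have Pell : (chebyshev_poly R (2 * k) \Po g) ^+ 2 -
    'X * ('X - e2%:P) * ('X - e3%:P) * ('X - e4%:P) * (kap%:P * (u \Po g)) ^+ 2 = 1.
  rewrite exprMn mulrCA mulrA -(sqr_sub1_factor sum prod) -/g.
  have := congr1 (comp_poly g) Tu.
  by rewrite !(rmorphB, rmorphM, rmorphXn, rmorph1) /= comp_polyX.
have sT : size (chebyshev_poly R (2 * k) \Po g) = (4 * k).+1.
  have := size_comp_poly (chebyshev_poly R (2 * k)) g.
  rewrite size_chebyshev_poly sg; move: (size _) => n /=; lia.
have sD : (1 < size ('X * ('X - e2%:P) * ('X - e3%:P) * ('X - e4%:P))%R)%N.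
  by rewrite !size_mul ?mulf_neq0 ?polyX_eq0 ?polyXsubC_eq0 // !size_XsubC size_polyX.
have sp1 : (1 < size p)%N by rewrite sp; lia.
have spT : size p = size (chebyshev_poly R (2 * k) \Po g) by rewrite sp sT.
have [->|->] := pell_unique sD sp1 spT pell Pell.
  by exists 1; rewrite ?oner_eq0 // => s; rewrite horner_comp gs mul1r.
exists (-1); rewrite ?oppr_eq0 ?oner_eq0 // => s.
by rewrite hornerN horner_comp gs mulN1r.
Qed.

(** * Counting crossings of the vertical axis *)

Definition axis_hit {R : realType} (x y : R) : bool := (x == 0) || (x * y < 0).

Definition det2 {R : realType} (u v : R * R) : R := u.1 * v.2 - u.2 * v.1.

(** A segment not inside the axis meets it at most once, at the parameter x / (x - x'), so hits
    inject into segment indices. The hypothesis on [P] excludes segments inside the axis. *)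
Lemma yaxis_hits_card (R : realType) (P : nat -> R * R) (n m : nat) :
  (forall i, (P i).1 = 0 -> (P i.+1).1 != 0) ->
  (@yaxis_hits R P n #= `I_m)%card ->
  m = (\sum_(i < n) axis_hit (P i).1 (P i.+1).1)%N.
Proof.
move=> nz card_m.
set H := fun i => axis_hit (P i).1 (P i.+1).1.
have hitE (i : 'I_n) (t : R) : @yaxis_hits R P n (i, t) ->
    ((P i).1 - (P i.+1).1 != 0) /\ t = (P i).1 / ((P i).1 - (P i.+1).1).
  move=> [/= /andP[t0 t1] eqt].
  have d0 : (P i).1 - (P i.+1).1 != 0.
    apply/eqP => d0; have e : (P i.+1).1 = (P i).1 by lra.
    have x0 : (P i).1 = 0 by rewrite e in eqt; lra.
    by have := nz _ x0; rewrite e x0 eqxx.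
  split=> //; apply: (mulIf d0); rewrite mulfVK //; lra.
have inj : {in @yaxis_hits R P n &, injective (fun u : 'I_n * R => u.1 : nat)}.
  move=> [i t] [j s] /set_mem hi /set_mem hj /= /val_inj ij.
  move: hj; rewrite -ij => hj.
  by rewrite (hitE _ _ hi).2 (hitE _ _ hj).2.
have img : ((fun u : 'I_n * R => u.1 : nat) @` @yaxis_hits R P n =
    [set` [fset i in [seq i <- iota 0 n | H i]]%fset])%classic.
  apply/seteqP; split=> [i /= [[j t] hj <-]|i /=].
    rewrite !inE mem_filter mem_iota add0n ltn_ord /= andbT.
    have [d0 tE] := hitE _ _ hj; case: hj => /= /andP[t0 t1] eqt.
    rewrite /H /axis_hit; case: eqP => //= x0.
    have tpos : 0 < t.
      rewrite lt_def t0 andbT; apply/eqP => te; apply: x0; rewrite te in eqt; lra.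
    rewrite -(pmulr_rlt0 _ tpos).
    have -> : t * ((P j).1 * (P j.+1).1) = - ((1 - t) * (P j).1 ^+ 2).
      have e : t * (P j.+1).1 = - ((1 - t) * (P j).1) by lra.
      by rewrite mulrCA e; ring.
    rewrite oppr_lt0 mulr_gt0 ?subr_gt0 // exprn_even_gt0 //.
    exact/eqP.
  rewrite !inE mem_filter mem_iota add0n /= => /andP[Hi lt_in].
  have d0 : (P i).1 - (P i.+1).1 != 0.
    rewrite subr_eq0; apply/eqP => e; case/orP: Hi => [/eqP x0|].
      by have := nz _ x0; rewrite -e x0 eqxx.
    by rewrite -e -expr2 ltNge sqr_ge0.
  exists (Ordinal lt_in, (P i).1 / ((P i).1 - (P i.+1).1)) => //.
  split=> /=; last by field.
  case/orP: Hi => [/eqP ->|neg]; first by rewrite mul0r lexx ltr01.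
  have s2 : 0 < ((P i).1 - (P i.+1).1) ^+ 2 by rewrite exprn_even_gt0.
  (* Over a squared denominator the bounds on the parameter become polynomial inequalities. *)
  have -> : (P i).1 / ((P i).1 - (P i.+1).1) =
      ((P i).1 ^+ 2 - (P i).1 * (P i.+1).1) / ((P i).1 - (P i.+1).1) ^+ 2.
    by field.
  apply/andP; split.
    by rewrite divr_ge0 ?(ltW s2) //; have := sqr_ge0 (P i).1; lra.
  by rewrite ltr_pdivrMr // mul1r; have := sqr_ge0 (P i.+1).1; nra.
have : ([set` [fset i in [seq i <- iota 0 n | H i]]%fset] #= `I_m)%card.
  by rewrite -img; apply: card_eq_trans card_m; apply: inj_card_eq.
move/card_eq_fsetP => <-.
rewrite card_fseq undup_id ?filter_uniq ?iota_uniq // size_filter -sum1_count.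
have -> : iota 0 n = index_iota 0 n by rewrite /index_iota subn0.
by rewrite big_mkcond big_mkord.
Qed.

Lemma sum_nat_pairs (H : nat -> nat) (k : nat) :
  (\sum_(i < k.*2) H i = \sum_(j < k) (H j.*2 + H j.*2.+1))%N.
Proof.
elim: k => [|k IH]; first by rewrite !big_ord0.
by rewrite doubleS !big_ord_recr /= IH addnA.
Qed.

(** First coordinate of the linear relation that Cramer's rule gives between three plane vectors. *)
Lemma det2_cyclic (R : realType) (u v w : R * R) :
  det2 v w * u.1 + det2 w u * v.1 + det2 u v * w.1 = 0.
Proof. by rewrite /det2; ring. Qed.

(** Here [v] is a positive combination of [u] and [w], so the axis cannot separate it from both; and
    if [u] is on the axis, [v] and [w] are on the same side. *)
Lemma axis_hit_lt_half_turn (R : realType) (u v w : R * R) :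
  0 < det2 u v -> 0 < det2 v w -> 0 < det2 u w ->
  (axis_hit u.1 v.1 + axis_hit v.1 w.1 <= 1)%N.
Proof.
move=> uv vw uw; have := det2_cyclic u v w.
have -> : det2 w u = - det2 u w by rewrite /det2; ring.
move: (uv); rewrite /axis_hit {1}/det2.
case: eqVneq => [->|u0]; case: eqVneq => [->|v0] //=.
- by rewrite !mul0r mulr0 subrr ltxx.
- move=> _; case: (ltrP (v.1 * w.1) 0) => // vw0.
  have v2 : 0 < v.1 ^+ 2 by rewrite exprn_even_gt0.
  by move=> /(congr1 (fun x => v.1 * x)); rewrite !mulr0 add0r; nra.
- by rewrite !mulr0 ltxx.
move=> _; case: (ltrP (u.1 * v.1) 0) => // uv0;
  case: (ltrP (v.1 * w.1) 0) => // vw0.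
have v2 : 0 < v.1 ^+ 2 by rewrite exprn_even_gt0.
move=> /(congr1 (fun x => v.1 * x)); rewrite mulr0 => cyc.
nra.
Qed.

(** Here 0 is a positive combination of the three vectors, so their first coordinates cannot all
    have the sign of a nonzero [v.1]. *)
Lemma axis_hit_gt_half_turn (R : realType) (u v w : R * R) :
  0 < det2 u v -> 0 < det2 v w -> det2 u w < 0 ->
  (1 <= axis_hit u.1 v.1 + axis_hit v.1 w.1)%N.
Proof.
move=> uv vw uw; rewrite lt0n addn_eq0 !eqb0 !negb_or -!leNgt.
apply/negP => /andP[/andP[u0 uv0] /andP[v0 vw0]].
have := det2_cyclic u v w.
have -> : det2 w u = - det2 u w by rewrite /det2; ring.
have v2 : 0 < v.1 ^+ 2 by rewrite exprn_even_gt0.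
move=> /(congr1 (fun x => v.1 * x)); rewrite mulr0; nra.
Qed.

(* [u] turns counterclockwise by less than pi at each step, so a hit means that
   the vertical axis is met between [u i] (included) and [u i.+1]. If two
   consecutive steps together always turn by more than pi, each pair of steps
   hits and the first pair, starting on the axis, does so twice; if they turn
   by less than pi, each pair hits at most once and the last pair, which ends
   on the axis, does not hit. *)
Lemma half_turn_hits (R : realType) (u : nat -> R * R) (k : nat) :
  (0 < k)%N ->
  (forall i, 0 < det2 (u i) (u i.+1)) ->
  (u 0%N).1 = 0 -> (u k.*2).1 = 0 ->
  (forall i, det2 (u i) (u i.+2) < 0) \/ (forall i, 0 < det2 (u i) (u i.+2)) ->
  (\sum_(i < k.*2) axis_hit (u i).1 (u i.+1).1)%N <> k.
Proof.
case: k => // k _ turn start finish half.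
set H := fun i : nat => axis_hit (u i).1 (u i.+1).1 : nat.
rewrite (sum_nat_pairs H).
case: half => half.
- have pair i : (1 <= H i + H i.+1)%N by apply: axis_hit_gt_half_turn.
  have first : (H 0 + H 1 = 2)%N.
    have := turn 0%N; have := half 0%N; rewrite /H /axis_hit /det2 start eqxx.
    rewrite !mul0r !sub0r /= oppr_lt0 oppr_gt0 => u02 u01.
    suff -> : (u 1%N).1 * (u 2%N).1 < 0 by rewrite orbT.
    by have := sqr_ge0 (u 0%N).2; nra.
  rewrite big_ord_recl /= first => eqk.
  have : (\sum_(j < k) 1 <= \sum_(j < k) (H (bump 0 j).*2 + H (bump 0 j).*2.+1))%N.
    by apply: leq_sum => j _; apply: pair.
  by rewrite sum_nat_const card_ord muln1 -(leq_add2l 2) eqk; lia.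
- have pair i : (H i + H i.+1 <= 1)%N by apply: axis_hit_lt_half_turn.
  have final : (H k.*2 + H k.*2.+1 = 0)%N.
    have := turn k.*2.+1; have := half k.*2; rewrite doubleS in finish.
    rewrite /H /axis_hit /det2 finish !mulr0 !subr0 ltxx orbF => u02 u12.
    have /lt0r_neq0 : 0 < (u k.*2).1 * (u k.*2.+1).1.
      by have := sqr_ge0 (u k.*2.+2).2; nra.
    rewrite mulf_eq0 negb_or => /andP[/negPf -> /negPf ->] /=.
    rewrite ltNge; suff -> : 0 <= (u k.*2).1 * (u k.*2.+1).1 by [].
    by have := sqr_ge0 (u k.*2.+2).2; nra.
  rewrite big_ord_recr /= final => eqk.
  have : (\sum_(j < k) (H j.*2 + H j.*2.+1) <= \sum_(j < k) 1)%N.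
    by apply: leq_sum => j _; apply: pair.
  by rewrite sum_nat_const card_ord muln1 -[X in (X <= _)%N]addn0 eqk ltnn.
Qed.

(* The vertex (a * nx, b * ny) of a trajectory, whose outgoing chord has direction
   slope * (tangent) - (normal) with normal = (nx, ny), tangent = (-ny, nx). *)
Record bounce (R : Type) := Bounce { nx : R; ny : R; slope : R }.

(** * The billiard map and its reversal *)

Section Bounce.
Context {R : realType}.
Implicit Types (a b lam : R) (z : bounce R).

Definition dirx z : R := - (slope z * ny z) - nx z.

Definition diry z : R := slope z * nx z - ny z.

Definition normal_sq z : R := nx z ^+ 2 + ny z ^+ 2.

(** This is [a * b] times the quadratic form of the ellipse at the chord direction. *)
Definition dir_form a b z : R := b * dirx z ^+ 2 + a * diry z ^+ 2.

(** The new vertex is the second intersection of the chord with the ellipse. The new slope is the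
    ratio of tangential to normal component with which the chord arrives there; reflection only
    flips the normal one. *)
Definition next a b z : bounce R :=
  Bounce (nx z + 2 * normal_sq z * b * dirx z / dir_form a b z)
         (ny z + 2 * normal_sq z * a * diry z / dir_form a b z)
         (slope z - 2 * (a - b) * dirx z * diry z / dir_form a b z).

Definition reverse z : bounce R := Bounce (nx z) (ny z) (- slope z).

(* The vertex lies on the ellipse and the outgoing line is tangent to the caustic:
   for a chord v at a point with normal n, tangency to the conic lam amounts to
   a * b * (v . n)^2 = lam * |v|^2. *)
Definition touches a b lam z : Prop :=
  a * nx z ^+ 2 + b * ny z ^+ 2 = 1 /\
  lam * (slope z ^+ 2 + 1) = a * b * normal_sq z.

Definition foot a b z : R * R := (a * nx z, b * ny z).

Lemma touches_reverse a b lam z : touches a b lam z -> touches a b lam (reverse z).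
Proof. by case=> e t; split; rewrite //= sqrrN. Qed.

Lemma dirx_reverse z : dirx (reverse z) = slope z * ny z - nx z.
Proof. by rewrite /dirx /= mulNr opprK. Qed.

Lemma diry_reverse z : diry (reverse z) = - (slope z * nx z) - ny z.
Proof. by rewrite /diry /= mulNr. Qed.

Lemma normal_sq_gt0 a b lam z : 0 < b -> b < a -> touches a b lam z ->
  0 < normal_sq z.
Proof.
move=> b0 ba [e _]; rewrite /normal_sq; case: z e => c d g /= e.
have c2 := sqr_ge0 c; have d2 := sqr_ge0 d; nra.
Qed.

Lemma dir_sq z : dirx z ^+ 2 + diry z ^+ 2 =
  normal_sq z * (slope z ^+ 2 + 1).
Proof. by rewrite /dirx /diry /normal_sq /=; ring. Qed.

Lemma dir_form_gt0 a b lam z : 0 < b -> b < a -> touches a b lam z ->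
  0 < dir_form a b z.
Proof.
move=> b0 ba t; have N0 := normal_sq_gt0 b0 ba t.
have := dir_sq z; rewrite /dir_form; move: (dirx z) (diry z) => x y E.
have h1 : 0 < x ^+ 2 + y ^+ 2 by rewrite E mulr_gt0 // ltr_pwDr // sqr_ge0.
have x2 := sqr_ge0 x; have y2 := sqr_ge0 y; nra.
Qed.

Lemma nx_next a b z :
  nx (next a b z) = nx z + 2 * normal_sq z * b * dirx z / dir_form a b z.
Proof. by []. Qed.

Lemma ny_next a b z :
  ny (next a b z) = ny z + 2 * normal_sq z * a * diry z / dir_form a b z.
Proof. by []. Qed.

Lemma slope_next a b z : slope (next a b z) =
  slope z - 2 * (a - b) * dirx z * diry z / dir_form a b z.
Proof. by []. Qed.

(** The form of the ellipse takes equal values at both ends of the chord, so the direction has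
    opposite products with the two normals. *)
Lemma dir_normal_next a b z : 0 < dir_form a b z ->
  dirx z * nx (next a b z) + diry z * ny (next a b z) = normal_sq z.
Proof.
move=> q0; have q := lt0r_neq0 q0; rewrite nx_next ny_next.
transitivity (dirx z * nx z + diry z * ny z +
    2 * normal_sq z *
      ((b * dirx z ^+ 2 + a * diry z ^+ 2) / dir_form a b z)); first by ring.
by rewrite -/(dir_form a b z) divff // /dirx /diry /normal_sq /=; ring.
Qed.

Lemma dir_tangent_next a b z :
  diry z * nx (next a b z) - dirx z * ny (next a b z) =
  normal_sq z * slope (next a b z).
Proof.
by rewrite nx_next ny_next slope_next /normal_sq /dirx /diry /=; ring.
Qed.

(** The two preceding identities give the components of the chord in the frame of the new vertex;
    solved for the direction, they say that the reversed motion retraces the chord. *)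
Lemma next_dir a b z : 0 < dir_form a b z ->
  normal_sq (next a b z) * dirx z =
    - normal_sq z * dirx (reverse (next a b z)) /\
  normal_sq (next a b z) * diry z =
    - normal_sq z * diry (reverse (next a b z)).
Proof.
move=> q0; have n := dir_normal_next q0; have t := dir_tangent_next a b z.
move: n t; move: (next a b z) => [c d g]; rewrite /normal_sq /dirx /diry /=.
set v1 := - (slope z * ny z) - nx z; set v2 := slope z * nx z - ny z => n t.
set N := nx z ^+ 2 + ny z ^+ 2 in n t *.
split.
  transitivity (c * (v1 * c + v2 * d) - d * (v2 * c - v1 * d)); first by ring.
  by rewrite n t /N; ring.
transitivity (d * (v1 * c + v2 * d) + c * (v2 * c - v1 * d)); first by ring.
by rewrite n t /N; ring.
Qed.

Lemma next_on_ellipse a b z : 0 < dir_form a b z ->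
  a * nx z ^+ 2 + b * ny z ^+ 2 = 1 ->
  a * nx (next a b z) ^+ 2 + b * ny (next a b z) ^+ 2 = 1.
Proof.
move=> q0 e; have q := lt0r_neq0 q0; rewrite nx_next ny_next.
set N := normal_sq z;  set Q := dir_form a b z.
transitivity (a * nx z ^+ 2 + b * ny z ^+ 2 +
  4 * a * b * N / Q * (nx z * dirx z + ny z * diry z +
    N * ((b * dirx z ^+ 2 + a * diry z ^+ 2) / Q))).
  by field.
rewrite -[b * dirx z ^+ 2 + _]/Q divff // e /N /normal_sq /dirx /diry /=; ring.
Qed.

Lemma touches_next a b lam z : 0 < b -> b < a ->
  touches a b lam z -> touches a b lam (next a b z).
Proof.
move=> b0 ba tz; have q0 := dir_form_gt0 b0 ba tz; have N0 := normal_sq_gt0 b0 ba tz.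
case: tz => e t; split; first exact: next_on_ellipse.
have N1 := lt0r_neq0 N0; apply: (mulfI N1).
have n := dir_normal_next q0; have s := dir_tangent_next a b z.
(* Computing the squared length of the direction in the frames of both ends shows that
   [(slope ^+ 2 + 1) / normal_sq] is conserved. *)
have E : normal_sq z * ((slope (next a b z)) ^+ 2 + 1) =
  normal_sq (next a b z) * (slope z ^+ 2 + 1).
  apply: (mulfI N1).
  transitivity ((normal_sq z * slope (next a b z)) ^+ 2 + normal_sq z ^+ 2); first by ring.
  rewrite -s -{1}n.
  transitivity (normal_sq (next a b z) * (dirx z ^+ 2 + diry z ^+ 2)).
    rewrite {1}/normal_sq; ring.
  by rewrite dir_sq; ring.
by rewrite mulrCA E mulrCA t; ring.
Qed.

(** The reversed direction is a negative multiple of the old one, with a factor that the formulas of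
    [next] absorb. This gives access to the previous vertex. *)
Lemma next_reverse a b lam z : 0 < b -> b < a -> touches a b lam z ->
  reverse (next a b (reverse (next a b z))) = z.
Proof.
move=> b0 ba tz; have q0 := dir_form_gt0 b0 ba tz; have N0 := normal_sq_gt0 b0 ba tz.
have tz' := touches_reverse (touches_next b0 ba tz).
have N0' := normal_sq_gt0 b0 ba tz'; have q0' := dir_form_gt0 b0 ba tz'.
have [d1 d2] := next_dir q0.
set w := reverse (next a b z) in d1 d2 tz' N0' q0' *.
have NE : normal_sq (next a b z) = normal_sq w by [].
have N1 := lt0r_neq0 N0; have N1' := lt0r_neq0 N0'.
have q1 := lt0r_neq0 q0.
have w1 : dirx w = - (normal_sq w / normal_sq z) * dirx z.
  by apply: (mulfI N1); rewrite -[LHS]opprK -mulNr -d1 NE; field.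
have w2 : diry w = - (normal_sq w / normal_sq z) * diry z.
  by apply: (mulfI N1); rewrite -[LHS]opprK -mulNr -d2 NE; field.
have Qw : dir_form a b w = (normal_sq w / normal_sq z) ^+ 2 * dir_form a b z.
  by rewrite /dir_form w1 w2; ring.
have [cE dE gE] : [/\ nx w = nx (next a b z), ny w = ny (next a b z) &
   slope w = - slope (next a b z)] by [].
have -> : z = Bounce (nx z) (ny z) (slope z) by case: (z).
rewrite /reverse nx_next ny_next slope_next Qw w1 w2 cE dE gE.
rewrite !(nx_next, ny_next, slope_next).
by congr Bounce; field; exact/and3P.
Qed.

(** * Chords, their moments and the caustic *)

Definition stride a b z : R := 2 * normal_sq z * a * b / dir_form a b z.

Lemma foot_next1 a b z :
  (foot a b (next a b z)).1 - (foot a b z).1 = stride a b z * dirx z.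
Proof. by rewrite /stride /foot /=; ring. Qed.

Lemma foot_next2 a b z :
  (foot a b (next a b z)).2 - (foot a b z).2 = stride a b z * diry z.
Proof. by rewrite /stride /foot /=; ring. Qed.

Lemma stride_gt0 a b lam z : 0 < b -> b < a -> touches a b lam z ->
  0 < stride a b z.
Proof.
move=> b0 ba tz; have a0 : 0 < a := lt_trans b0 ba.
have q0 := dir_form_gt0 b0 ba tz; have N0 := normal_sq_gt0 b0 ba tz.
by rewrite /stride !(mulr_gt0, invr_gt0).
Qed.

(** Angular momentum of the outgoing direction about the centre; its sign tells on which side the
    chord passes the centre. *)
Definition moment a b z : R :=
  (foot a b z).1 * diry z - (foot a b z).2 * dirx z.

(** This is the dual equation of the caustic, that is, tangency in line coordinates. It follows from
    a Lagrange identity with weights [a] and [b]. *)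
Lemma moment_sq a b lam z : touches a b lam z ->
  moment a b z ^+ 2 = (a - lam) * diry z ^+ 2 + (b - lam) * dirx z ^+ 2.
Proof.
case=> e t; have s := dir_sq z.
have {}s : lam * (dirx z ^+ 2 + diry z ^+ 2) = a * b * normal_sq z ^+ 2.
  by rewrite s mulrCA t; ring.
have vn : dirx z * nx z + diry z * ny z = - normal_sq z.
  by rewrite /dirx /diry /normal_sq /=; ring.
rewrite /moment /foot /=.
transitivity ((a * diry z ^+ 2 + b * dirx z ^+ 2) *
    (a * nx z ^+ 2 + b * ny z ^+ 2)
    - a * b * (dirx z * nx z + diry z * ny z) ^+ 2); first by ring.
by rewrite e vn sqrrN -s; ring.
Qed.

Lemma foot_neq a b lam z : 0 < b -> b < a -> touches a b lam z ->
  foot a b z <> foot a b (next a b z).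
Proof.
move=> b0 ba tz e; have q0 := dir_form_gt0 b0 ba tz.
have p0 := lt0r_neq0 (stride_gt0 b0 ba tz).
have v1 : dirx z = 0.
  by apply: (mulfI p0); rewrite -foot_next1 e subrr mulr0.
have v2 : diry z = 0.
  by apply: (mulfI p0); rewrite -foot_next2 e subrr mulr0.
by move: q0; rewrite /dir_form v1 v2 expr0n !mulr0 addr0 ltxx.
Qed.

Lemma foot_tangent_line a b lam z : 0 < b -> b < a -> lam != a -> lam != b ->
  touches a b lam z -> tangent_line a b lam (foot a b z) (foot a b (next a b z)).
Proof.
move=> b0 ba la lb tz; have q0 := dir_form_gt0 b0 ba tz.
have msq := moment_sq tz; split; first exact: foot_neq tz.
have la0 : a - lam != 0 by rewrite subr_eq0 eq_sym.
have lb0 : b - lam != 0 by rewrite subr_eq0 eq_sym.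
(* The pole of the chord with respect to the caustic; its last coordinate vanishes when the chord
   passes through the centre. *)
exists ((a - lam) * diry z), (- ((b - lam) * dirx z)), (moment a b z); split.
- case=> /eqP + /eqP + _; rewrite oppr_eq0 !mulf_eq0 (negPf la0) (negPf lb0) /=.
  move=> /eqP v2 /eqP v1; move: q0.
  by rewrite /dir_form v1 v2 expr0n !mulr0 addr0 ltxx.
- by rewrite msq; field; rewrite la0 lb0.
- by rewrite /moment; field; rewrite la0 lb0.
- have := foot_next1 a b z; have := foot_next2 a b z.
  move=> /eqP + /eqP; rewrite !subr_eq => /eqP -> /eqP ->.
  by rewrite /moment; field; rewrite la0 lb0.
Qed.

Lemma foot_on_ellipse a b lam z : a != 0 -> b != 0 -> touches a b lam z ->
  on_conic a b 0 (foot a b z).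
Proof.
move=> a0 b0 [e _]; rewrite /on_conic /foot /= !subr0 -e; field; exact/andP.
Qed.

Lemma foot_reflection_law a b lam z : 0 < b -> b < a -> touches a b lam z ->
  reflection_law a b (foot a b z) (foot a b (next a b z))
    (foot a b (next a b (next a b z))).
Proof.
move=> b0 ba tz; have tz' := touches_next b0 ba tz.
have a0 : 0 < a := lt_trans b0 ba.
have q0 := dir_form_gt0 b0 ba tz; have q0' := dir_form_gt0 b0 ba tz'.
have N0 := normal_sq_gt0 b0 ba tz; have N0' := normal_sq_gt0 b0 ba tz'.
have [d1 d2] := next_dir q0; have vn := dir_normal_next q0.
have N1 := lt0r_neq0 N0'; have q1 := lt0r_neq0 q0'; have q2 := lt0r_neq0 q0.
rewrite /reflection_law /reflect_dir !foot_next1 !foot_next2.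
have -> : (foot a b (next a b z)).1 / a = nx (next a b z).
  by rewrite /foot /= mulrAC divff ?mul1r ?lt0r_neq0.
have -> : (foot a b (next a b z)).2 / b = ny (next a b z).
  by rewrite /foot /= mulrAC divff ?mul1r ?lt0r_neq0.
rewrite [X in _ / X]/= -/(normal_sq (next a b z)).
have p0 := stride_gt0 b0 ba tz; have p0' := stride_gt0 b0 ba tz'.
have x1 : dirx z = - (normal_sq z / normal_sq (next a b z)) *
    dirx (reverse (next a b z)).
  by apply: (mulfI N1); rewrite d1; field.
have y1 : diry z = - (normal_sq z / normal_sq (next a b z)) *
    diry (reverse (next a b z)).
  by apply: (mulfI N1); rewrite d2; field.
set z' := next a b z in N0' N1 tz' q0' q1 d1 d2 vn p0' x1 y1 *.
set p := stride a b z in p0 *; set p' := stride a b z' in p0' *.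
rewrite /=.
have -> : p * dirx z * nx z' + p * diry z * ny z' = p * normal_sq z.
  by rewrite -vn; ring.
(* The reflected incoming chord is [p * (normal_sq z / normal_sq z')] times the new direction, and
   the outgoing chord is [p'] times it. *)
exists (p' / (p * (normal_sq z / normal_sq z'))).
  by rewrite !(mulr_gt0, invr_gt0).
have N2 := lt0r_neq0 N0; have p1 := lt0r_neq0 p0.
have xE : p * dirx z - 2 * (p * normal_sq z) / normal_sq z' * nx z' =
    p * (normal_sq z / normal_sq z') * dirx z'.
  by rewrite x1 dirx_reverse /dirx; field.
have yE : p * diry z - 2 * (p * normal_sq z) / normal_sq z' * ny z' =
    p * (normal_sq z / normal_sq z') * diry z'.
  by rewrite y1 diry_reverse /diry; field.
by rewrite xE yE; congr pair; field; rewrite N1 N2 p1.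
Qed.

(** * Sense of rotation for an elliptic caustic *)

Lemma momentE a b lam z : touches a b lam z ->
  moment a b z = slope z - (a - b) * nx z * ny z.
Proof.
case=> e _; transitivity (slope z * (a * nx z ^+ 2 + b * ny z ^+ 2)
  - (a - b) * nx z * ny z); last by rewrite e mulr1.
by rewrite /moment /foot /dirx /diry /=; ring.
Qed.

Lemma moment_reverseE a b lam z : touches a b lam z ->
  moment a b (reverse z) = - slope z - (a - b) * nx z * ny z.
Proof. by move/touches_reverse/momentE. Qed.

Lemma dir_formE a b lam z : touches a b lam z ->
  dir_form a b z = slope z ^+ 2 + (a + b) * normal_sq z - 1
                   - 2 * (a - b) * slope z * nx z * ny z.
Proof.
case=> e _; transitivity ((slope z ^+ 2 - 1) * (a * nx z ^+ 2 + b * ny z ^+ 2)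
  + (a + b) * normal_sq z - 2 * (a - b) * slope z * nx z * ny z); last by rewrite e; ring.
by rewrite /dir_form /dirx /diry /normal_sq; ring.
Qed.

(** A line has the same moment at all its points, and [next_dir] compares the direction vectors used
    at the two ends. *)
Lemma moment_next a b z : 0 < dir_form a b z ->
  normal_sq (next a b z) * moment a b z =
  - normal_sq z * moment a b (reverse (next a b z)).
Proof.
move=> q0; have [d1 d2] := next_dir q0.
have -> : moment a b z =
    (foot a b (next a b z)).1 * diry z - (foot a b (next a b z)).2 * dirx z.
  have := foot_next1 a b z; have := foot_next2 a b z.
  move=> /eqP + /eqP; rewrite !subr_eq => /eqP -> /eqP ->.
  by rewrite /moment; ring.
rewrite mulrBr mulrCA d2 [X in _ - X]mulrCA d1 /moment /foot.
rewrite [nx (reverse _)]/= [ny (reverse _)]/=; ring.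
Qed.

(** With m = [(a - b) * nx z * ny z], the two chords at a vertex have moments [slope z] - m and
    -[slope z] - m, so the claim says that they pass the centre on opposite sides. It holds since
    [lam < b] and the squared distance from the vertex to the centre is at most [a]. *)
Lemma slope_sq_gt a b lam z : 0 < b -> b < a -> 0 < lam < b ->
  touches a b lam z -> ((a - b) * nx z * ny z) ^+ 2 < slope z ^+ 2.
Proof.
move=> b0 ba /andP[l0 lb] tz; have N0 := normal_sq_gt0 b0 ba tz; case: tz => e t.
rewrite -subr_gt0 -(pmulr_rgt0 _ l0).
have -> : lam * (slope z ^+ 2 - ((a - b) * nx z * ny z) ^+ 2) =
  normal_sq z * (a * b - lam * (a ^+ 2 * nx z ^+ 2 + b ^+ 2 * ny z ^+ 2)).
  transitivity (lam * (slope z ^+ 2 + 1) - lam * ((a * nx z ^+ 2 + b * ny z ^+ 2) ^+ 2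
    + ((a - b) * nx z * ny z) ^+ 2)); first by rewrite e; ring.
  by rewrite t /normal_sq; ring.
rewrite mulr_gt0 // subr_gt0.
have : a ^+ 2 * nx z ^+ 2 + b ^+ 2 * ny z ^+ 2 <= a.
  rewrite -[leRHS]mulr1 -e -subr_ge0.
  have -> : a * (a * nx z ^+ 2 + b * ny z ^+ 2) - (a ^+ 2 * nx z ^+ 2 + b ^+ 2 * ny z ^+ 2)
    = b * (a - b) * ny z ^+ 2 by ring.
  by rewrite mulr_ge0 ?sqr_ge0 // mulr_ge0 ?subr_ge0 ?ltW.
move=> h; have a0 : 0 < a := lt_trans b0 ba; nra.
Qed.

Lemma moment_gt0 a b lam z : 0 < b -> b < a -> 0 < lam < b ->
  touches a b lam z -> (0 < moment a b z) = (0 < slope z).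
Proof.
move=> b0 ba hl tz; have := slope_sq_gt b0 ba hl tz; rewrite (momentE tz).
move: (slope z) ((a - b) * nx z * ny z) => g m lt; apply/idP/idP => h; nra.
Qed.

Lemma slope_next_gt0 a b lam z : 0 < b -> b < a -> 0 < lam < b ->
  touches a b lam z -> 0 < slope z -> 0 < slope (next a b z).
Proof.
move=> b0 ba hl tz g0; have tz' := touches_next b0 ba tz.
have N0 := normal_sq_gt0 b0 ba tz; have N0' := normal_sq_gt0 b0 ba tz'.
have m0 : 0 < moment a b z by rewrite (moment_gt0 b0 ba hl tz).
have := moment_next (dir_form_gt0 b0 ba tz) => E.
have m1 : moment a b (reverse (next a b z)) < 0.
  rewrite -(pmulr_rlt0 _ N0) -oppr_gt0 -mulNr -E mulr_gt0 //.
move: m1; have sq := slope_sq_gt b0 ba hl tz'.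
rewrite (moment_reverseE tz').
move: sq; move: (slope _) (_ * ny (next a b z)) => g m lt h; case: (ltrP 0 g) => // g1.
have mg : 0 < m + g by lra.
have mg' : 0 < m - g by lra.
by have := mulr_gt0 mg mg'; lra.
Qed.

Lemma ellipse_step_turn a b lam z : 0 < b -> b < a -> 0 < lam < b ->
  touches a b lam z -> 0 < slope z -> 0 < det2 (foot a b z) (foot a b (next a b z)).
Proof.
move=> b0 ba hl tz g0; have p0 := stride_gt0 b0 ba tz.
have -> : det2 (foot a b z) (foot a b (next a b z)) = stride a b z * moment a b z.
  have := foot_next1 a b z; have := foot_next2 a b z.
  move=> /eqP + /eqP; rewrite !subr_eq /det2 => /eqP -> /eqP ->.
  by rewrite /moment; ring.
by rewrite mulr_gt0 // (moment_gt0 b0 ba hl tz).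
Qed.

(* The vertex of [z] is the middle one of three: the chord to the previous vertex
   is obtained by running the trajectory backwards from [reverse z]. *)
Lemma ellipse_double_turn a b lam z : 0 < b -> b < a ->
  touches a b lam z ->
  let A := next a b (reverse z) in
  lam * det2 (foot a b A) (foot a b (next a b z)) =
  stride a b z * stride a b (reverse z) * slope z * (1 - lam * (a^-1 + b^-1)).
Proof.
move=> b0 ba tz A; have a0 : 0 < a := lt_trans b0 ba.
have tr := touches_reverse tz; have N0 := normal_sq_gt0 b0 ba tz.
have q0 := dir_form_gt0 b0 ba tz; have qr0 := dir_form_gt0 b0 ba tr.
have q := lt0r_neq0 q0; have qr := lt0r_neq0 qr0; have N := lt0r_neq0 N0.
have b1 := lt0r_neq0 b0; have a1 := lt0r_neq0 a0.
have -> : det2 (foot a b A) (foot a b (next a b z)) =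
    stride a b z * moment a b z - stride a b (reverse z) * moment a b (reverse z)
    - stride a b z * stride a b (reverse z) * 2 * normal_sq z * slope z.
  have f1 := foot_next1 a b z; have f2 := foot_next2 a b z.
  have r1 := foot_next1 a b (reverse z); have r2 := foot_next2 a b (reverse z).
  move: f1 f2 r1 r2 => /eqP + /eqP + /eqP + /eqP; rewrite !subr_eq.
  rewrite -/A /det2 => /eqP -> /eqP -> /eqP -> /eqP ->.
  move: (stride a b z) (stride a b (reverse z)) => p r.
  by rewrite /moment dirx_reverse diry_reverse /foot /dirx /diry /normal_sq /=; ring.
rewrite /stride (momentE tz) (momentE tr).
have Nr : normal_sq (reverse z) = normal_sq z by [].
rewrite Nr.
transitivity (2 * normal_sq z * a * b / (dir_form a b z * dir_form a b (reverse z)) *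
  (lam * ((slope z - (a - b) * nx z * ny z) * dir_form a b (reverse z) +
  (slope z + (a - b) * nx z * ny z) * dir_form a b z -
   4 * a * b * normal_sq z ^+ 2 * slope z))).
  rewrite /reverse [slope (Bounce _ _ _)]/= [nx (Bounce _ _ _)]/= [ny (Bounce _ _ _)]/=.
  rewrite -/(reverse z); field.
  by rewrite q qr.
have -> : lam * ((slope z - (a - b) * nx z * ny z) * dir_form a b (reverse z) +
  (slope z + (a - b) * nx z * ny z) * dir_form a b z -
   4 * a * b * normal_sq z ^+ 2 * slope z) =
   2 * slope z * normal_sq z * (a * b - lam * (a + b)).
  rewrite (dir_formE tz) (dir_formE tr) Nr.
  rewrite /reverse [slope (Bounce _ _ _)]/= [nx (Bounce _ _ _)]/= [ny (Bounce _ _ _)]/=.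
  case: tz => e t.
  (* The ellipse equation turns the mixed term into a polynomial in [normal_sq z]; the tangency
     relation then removes [slope z ^+ 2]. *)
  have m2 : ((a - b) * nx z * ny z) ^+ 2 = (a + b) * normal_sq z - a * b * normal_sq z ^+ 2 - 1.
    transitivity ((a + b) * normal_sq z * (a * nx z ^+ 2 + b * ny z ^+ 2) - a * b * normal_sq z ^+ 2
      - (a * nx z ^+ 2 + b * ny z ^+ 2) ^+ 2); last by rewrite e; ring.
    by rewrite /normal_sq; ring.
  transitivity (2 * slope z * (lam * (slope z ^+ 2 + 1) + lam * ((a + b) * normal_sq z - 2 -
     2 * ((a - b) * nx z * ny z) ^+ 2 - 2 * a * b * normal_sq z ^+ 2))); first by ring.
  by rewrite m2 t; ring.
by field; rewrite q qr a1 b1.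
Qed.

(** * Turning for a hyperbolic caustic *)

(** A squared moment is nonnegative, which makes each chord at least as steep as the asymptotes of
    the caustic; such a chord joins the upper arc to the lower one. *)
Lemma hyperbola_side a b lam z : 0 < b -> b < a -> b < lam < a ->
  touches a b lam z -> ny z * ny (next a b z) < 0.
Proof.
move=> b0 ba /andP[bl la] tz; have q0 := dir_form_gt0 b0 ba tz.
have N0 := normal_sq_gt0 b0 ba tz; have q := lt0r_neq0 q0.
have l0 : 0 < lam := lt_trans b0 bl.
rewrite -(pmulr_rlt0 _ q0).
have -> : dir_form a b z * (ny z * ny (next a b z)) =
    dirx z ^+ 2 - a * normal_sq z ^+ 2.
  transitivity (ny z ^+ 2 * dir_form a b z + 2 * normal_sq z * a * ny z * diry z).
    by rewrite ny_next; field.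
  rewrite (dir_formE tz); case: tz => e t.
  transitivity (dirx z ^+ 2 - a * normal_sq z ^+ 2 +
    (2 * slope z * nx z * ny z + normal_sq z) * (a * nx z ^+ 2 + b * ny z ^+ 2 - 1)).
    by rewrite /dirx /diry /normal_sq; ring.
  by rewrite e subrr mulr0 addr0.
have := sqr_ge0 (moment a b z); rewrite (moment_sq tz).
have := dir_sq z; case: tz => e t s; rewrite -(pmulr_rge0 _ l0).
have -> : diry z ^+ 2 = normal_sq z * (slope z ^+ 2 + 1) - dirx z ^+ 2 by rewrite -s; ring.
have -> : lam * ((a - lam) * (normal_sq z * (slope z ^+ 2 + 1) - dirx z ^+ 2) +
    (b - lam) * dirx z ^+ 2) =
  (a - lam) * normal_sq z * (lam * (slope z ^+ 2 + 1)) - lam * (a - b) * dirx z ^+ 2.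
  by ring.
rewrite t subr_ge0 => h; rewrite subr_lt0.
have c0 : 0 < lam * (a - b) by rewrite mulr_gt0 ?subr_gt0.
rewrite -(ltr_pM2l c0); apply: le_lt_trans h _; rewrite -subr_gt0.
have -> : lam * (a - b) * (a * normal_sq z ^+ 2) - (a - lam) * normal_sq z * (a * b * normal_sq z) =
  a * normal_sq z ^+ 2 * (a * (lam - b)) by ring.
by rewrite !mulr_gt0 ?exprn_gt0 ?subr_gt0 // (lt_trans b0 ba).
Qed.

(** Up to sign, the sum on the left is the determinant of the consecutive pairs ([nx], [slope]) once
    the sign of every other slope is changed. *)
Lemma hyperbola_step_turn a b lam z : 0 < b -> b < a -> touches a b lam z ->
  dir_form a b z * (nx z * slope (next a b z) + nx (next a b z) * slope z) =
  2 * (slope z ^+ 2 + (a - b) * nx z ^+ 2) * diry z.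
Proof.
move=> b0 ba tz; have q := lt0r_neq0 (dir_form_gt0 b0 ba tz).
transitivity (2 * nx z * slope z * dir_form a b z
   - 2 * (a - b) * nx z * dirx z * diry z + 2 * normal_sq z * b * slope z * dirx z).
  by rewrite nx_next slope_next; field.
rewrite (dir_formE tz); case: tz => e t.
transitivity (2 * (slope z ^+ 2 + (a - b) * nx z ^+ 2) * diry z +
  2 * (slope z * nx z - ny z * slope z ^+ 2) * (a * nx z ^+ 2 + b * ny z ^+ 2 - 1)).
  by rewrite /dirx /diry /normal_sq; ring.
by rewrite e subrr mulr0 addr0.
Qed.

(** Since [A] is reached backwards, its slope is minus that of the previous vertex, and the sum is
    the determinant of the pairs ([nx], [slope]) of the two neighbours of [z]. *)
Lemma hyperbola_double_turn a b lam z : 0 < b -> b < a -> touches a b lam z ->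
  let A := next a b (reverse z) in let C := next a b z in
  lam * (dir_form a b z * dir_form a b (reverse z) *
    (nx A * slope C + nx C * slope A)) =
  4 * ny z * (slope z ^+ 2 + (a - b) * nx z ^+ 2) * normal_sq z *
    (a * b - lam * (a - b)).
Proof.
move=> b0 ba tz A C; have tr := touches_reverse tz.
have q := lt0r_neq0 (dir_form_gt0 b0 ba tz).
have qr := lt0r_neq0 (dir_form_gt0 b0 ba tr).
have -> : dir_form a b z * dir_form a b (reverse z) * (nx A * slope C + nx C * slope A) =
  4 * ny z * (slope z ^+ 2 + (a - b) * nx z ^+ 2) *
    (slope z ^+ 2 + 1 - (a - b) * normal_sq z).
  rewrite /A /C !(nx_next, slope_next) dirx_reverse diry_reverse.
  have -> : normal_sq (reverse z) = normal_sq z by [].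
  have -> : nx (reverse z) = nx z by [].
  have -> : slope (reverse z) = - slope z by [].
  transitivity (
    - 2 * (a - b) * nx z * dirx z * diry z * dir_form a b (reverse z)
    - 2 * (a - b) * nx z * (slope z * ny z - nx z) * (- (slope z * nx z) - ny z) * dir_form a b z
    + 2 * normal_sq z * b * ((slope z * ny z - nx z) * (slope z * dir_form a b z
        - 2 * (a - b) * dirx z * diry z)
      - dirx z * (slope z * dir_form a b (reverse z)
        + 2 * (a - b) * (slope z * ny z - nx z) * (- (slope z * nx z) - ny z)))).
    by field; rewrite q qr.
  rewrite (dir_formE tz) (dir_formE tr).
  have -> : normal_sq (reverse z) = normal_sq z by [].
  have -> : nx (reverse z) = nx z by [].
  have -> : ny (reverse z) = ny z by [].
  have -> : slope (reverse z) = - slope z by [].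
  case: tz => e _; have e' : a * nx z ^+ 2 = 1 - b * ny z ^+ 2 by rewrite -e; ring.
  by rewrite /normal_sq /dirx /diry; ring: e'.
case: tz => _ t.
transitivity (4 * ny z * (slope z ^+ 2 + (a - b) * nx z ^+ 2) *
  (lam * (slope z ^+ 2 + 1) - lam * (a - b) * normal_sq z)); first by ring.
by rewrite t; ring.
Qed.

(** * Orbits, and the caustic forced by the winding numbers *)

Definition orbit a b z (i : nat) : bounce R := iter i (next a b) z.

Lemma touches_orbit a b lam z i : 0 < b -> b < a -> touches a b lam z ->
  touches a b lam (orbit a b z i).
Proof. by move=> b0 ba tz; elim: i => //= i; apply: touches_next. Qed.

Lemma orbit_trajectory a b lam z : 0 < b -> b < a -> touches a b lam z ->
  billiard_trajectory a b (fun i => foot a b (orbit a b z i)).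
Proof.
move=> b0 ba tz; have a0 := lt_trans b0 ba.
have t i := touches_orbit i b0 ba tz; split=> i.
- exact: foot_on_ellipse (lt0r_neq0 a0) (lt0r_neq0 b0) (t i).
- exact: foot_neq b0 ba (t i).
- exact: foot_reflection_law b0 ba (t i).
Qed.

Lemma orbit_caustic a b lam z : 0 < b -> b < a -> lam != a -> lam != b ->
  touches a b lam z -> has_caustic a b lam (fun i => foot a b (orbit a b z i)).
Proof.
by move=> b0 ba la lb tz i; apply: foot_tangent_line => //; apply: touches_orbit.
Qed.

Lemma exists_touching_top a b lam : 0 < b -> b < a -> 0 < lam < a ->
  exists z, [/\ touches a b lam z, nx z = 0, 0 < ny z & 0 < slope z].
Proof.
move=> b0 ba /andP[l0 la].
(* At the vertex (0, sqrt b) the tangency relation reads [lam * (slope z ^+ 2 + 1) = a]. *)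
exists (Bounce 0 (Num.sqrt b)^-1 (Num.sqrt ((a - lam) / lam))); split=> //=.
- have sb : (Num.sqrt b)^-1 ^+ 2 = b^-1 by rewrite exprVn sqr_sqrtr // ltW.
  have l1 := lt0r_neq0 l0; have b1 := lt0r_neq0 b0.
  split; rewrite /normal_sq /= sb expr0n /=; first by field.
  rewrite sqr_sqrtr ?divr_ge0 ?subr_ge0 ?ltW //; field; exact/andP.
- by rewrite invr_gt0 sqrtr_gt0.
- by rewrite sqrtr_gt0 divr_gt0 // subr_gt0.
Qed.

(** Only the first coordinate of [u] is tied to the vertices, so that the second one can be the
    height for an elliptic caustic and a signed slope for a hyperbolic one. *)
Lemma winding_no_half_turn a b lam k z (u : nat -> R * R) :
  0 < b -> b < a -> lam != a -> lam != b -> (0 < k)%N ->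
  (forall P : nat -> R * R,
    billiard_trajectory a b P -> has_caustic a b lam P ->
    periodic_trajectory P (4 * k) /\ winding_numbers P (4 * k) (4 * k) (2 * k)) ->
  touches a b lam z -> nx z = 0 ->
  (forall i, (u i).1 = (foot a b (orbit a b z i)).1) ->
  (forall i, 0 < det2 (u i) (u i.+1)) ->
  (forall i, det2 (u i) (u i.+2) < 0) \/ (forall i, 0 < det2 (u i) (u i.+2)) ->
  False.
Proof.
move=> b0 ba la lb k0 hper tz x0 uE turn half.
have [per [_ hits]] :=
  hper _ (orbit_trajectory b0 ba tz) (orbit_caustic b0 ba la lb tz).
have kE : (4 * k = (2 * k).*2)%N by lia.
have u0 : (u 0%N).1 = 0 by rewrite uE /foot /= x0 mulr0.
have uk : (u (2 * k).*2).1 = 0.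
  by rewrite uE -kE; have := per 0%N; rewrite add0n => ->; rewrite -uE.
have k2 : (0 < 2 * k)%N by lia.
apply: (half_turn_hits k2 turn u0 uk half).
rewrite -kE; symmetry; under eq_bigr do rewrite !uE.
apply: yaxis_hits_card hits => i; rewrite -!uE => ui; apply/eqP => ui1.
by have := turn i; rewrite /det2 ui ui1 mul0r mulr0 subrr ltxx.
Qed.

Lemma ellipse_caustic_quarter a b lam k :
  0 < b -> b < a -> 0 < lam < b -> (0 < k)%N ->
  (forall P : nat -> R * R,
    billiard_trajectory a b P -> has_caustic a b lam P ->
    periodic_trajectory P (4 * k) /\ winding_numbers P (4 * k) (4 * k) (2 * k)) ->
  lam^-1 = a^-1 + b^-1.
Proof.
move=> b0 ba hl k0 hper; have /andP[l0 lb] := hl.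
have la : lam < a := lt_trans lb ba.
have [|z [tz x0 _ g0]] := @exists_touching_top a b lam b0 ba; first by rewrite l0.
have t i := touches_orbit i b0 ba tz.
have g i : 0 < slope (orbit a b z i).
  by elim: i => //= i; apply: slope_next_gt0 hl (t i).
apply: (mulfI (lt0r_neq0 l0)); rewrite divff ?lt0r_neq0 //; apply/esym/eqP.
apply: contraT => ne; exfalso.
have double i : exists2 p, 0 < p &
    det2 (foot a b (orbit a b z i)) (foot a b (orbit a b z i.+2)) =
      p * (1 - lam * (a^-1 + b^-1)).
  have tm := t i.+1; have tr := touches_reverse tm.
  exists (stride a b (orbit a b z i.+1) * stride a b (reverse (orbit a b z i.+1)) *
    slope (orbit a b z i.+1) / lam).
    rewrite divr_gt0 // mulr_gt0 ?g // mulr_gt0 //.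
      exact: stride_gt0 tm.
    exact: stride_gt0 tr.
  have := ellipse_double_turn b0 ba tm; cbv zeta.
  have -> : foot a b (next a b (reverse (orbit a b z i.+1))) = foot a b (orbit a b z i).
    by rewrite -[in RHS](next_reverse b0 ba (t i)).
  move=> /(congr1 (fun x => x / lam)) E.
  by rewrite mulrAC -E mulrAC divff ?mul1r ?lt0r_neq0.
apply: (winding_no_half_turn b0 ba _ _ k0 hper tz x0
  (u := fun i => foot a b (orbit a b z i))) => //.
- by rewrite lt_eqF.
- by rewrite lt_eqF.
- by move=> i; apply: ellipse_step_turn hl (t i) (g i).
have [lt|ge] := ltrP (1 - lam * (a^-1 + b^-1)) 0; [left|right] => i.
  by have [p p0 ->] := double i; rewrite pmulr_rlt0.
have [p p0 ->] := double i; rewrite mulr_gt0 // lt_def ge andbT subr_eq0 eq_sym.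
exact: ne.
Qed.

Lemma hyperbola_caustic_quarter a b lam k :
  0 < b -> b < a -> b < lam < a -> (0 < k)%N ->
  (forall P : nat -> R * R,
    billiard_trajectory a b P -> has_caustic a b lam P ->
    periodic_trajectory P (4 * k) /\ winding_numbers P (4 * k) (4 * k) (2 * k)) ->
  lam^-1 = b^-1 - a^-1.
Proof.
move=> b0 ba hl k0 hper; have /andP[bl la] := hl.
have l0 : 0 < lam := lt_trans b0 bl; have a0 : 0 < a := lt_trans b0 ba.
have [|z [tz x0 y0 _]] := @exists_touching_top a b lam b0 ba; first by rewrite l0.
have t i := touches_orbit i b0 ba tz.
have y i : 0 < (-1) ^+ i * ny (orbit a b z i).
  elim: i => [|i IH]; first by rewrite expr0 mul1r.
  have := hyperbola_side b0 ba hl (t i); rewrite -/(orbit a b z i.+1) => side.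
  rewrite -(pmulr_rgt0 _ IH) exprS mulN1r mulNr mulrN mulrACA -expr2 sqrr_sign mul1r.
  by rewrite oppr_gt0.
have pos i : 0 < slope (orbit a b z i) ^+ 2 + (a - b) * nx (orbit a b z i) ^+ 2.
  have [e s] := t i; rewrite -(pmulr_rgt0 _ l0).
  have -> : lam * (slope (orbit a b z i) ^+ 2 + (a - b) * nx (orbit a b z i) ^+ 2) =
     b * (a - lam) * normal_sq (orbit a b z i).
    transitivity (lam * (slope (orbit a b z i) ^+ 2 + 1) -
      lam * (1 - (a - b) * nx (orbit a b z i) ^+ 2)); first by ring.
    by rewrite s -{1}e /normal_sq; ring.
  by rewrite !mulr_gt0 ?subr_gt0 // (normal_sq_gt0 b0 ba (t i)).
have q i := dir_form_gt0 b0 ba (t i).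
have qr i := dir_form_gt0 b0 ba (touches_reverse (t i)).
have N i := normal_sq_gt0 b0 ba (t i).
suff : a * b - lam * (a - b) = 0.
  move=> /eqP; rewrite subr_eq0 => /eqP E; apply: (mulfI (lt0r_neq0 l0)).
  rewrite divff ?lt0r_neq0 //; apply: (mulfI (mulf_neq0 (lt0r_neq0 a0) (lt0r_neq0 b0))).
  by rewrite mulr1 {1}E; field; rewrite !lt0r_neq0.
apply/eqP; apply: contraT => ne; exfalso.
(* The signs undo the alternation of the vertices between the upper and the
   lower arc of the ellipse. *)
pose u i := (a * nx (orbit a b z i), (-1) ^+ i * slope (orbit a b z i)).
have det2E (x1 y1 x2 y2 : R) : det2 (x1, y1) (x2, y2) = x1 * y2 - y1 * x2 by [].
have double i : exists2 p, p < 0 & det2 (u i) (u i.+2) = p * (a * b - lam * (a - b)).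
  set m := orbit a b z i.+1; have E := hyperbola_double_turn b0 ba (t i.+1); cbv zeta in E.
  exists (- (a * ((-1) ^+ i.+1 * ny m) * 4 * (slope m ^+ 2 + (a - b) * nx m ^+ 2) *
     normal_sq m / (lam * (dir_form a b m * dir_form a b (reverse m))))).
    have := y i.+1; rewrite -/m; move: ((-1) ^+ i.+1 * ny m) => s s0.
    rewrite oppr_lt0 !(mulr_gt0, invr_gt0) //; [exact: pos|exact: N|exact: q|exact: qr].
  have [xA sA] : nx (next a b (reverse m)) = nx (orbit a b z i) /\
      slope (next a b (reverse m)) = - slope (orbit a b z i).
    by have := next_reverse b0 ba (t i); rewrite -/m => <-; rewrite /= opprK.
  move: E; rewrite -/m xA sA -/(orbit a b z i.+2) => E.
  have qm := lt0r_neq0 (q i.+1); have qrm := lt0r_neq0 (qr i.+1).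
  have l1 := lt0r_neq0 l0.
  apply: (mulfI (mulf_neq0 l1 (mulf_neq0 qm qrm))).
  transitivity (a * (-1) ^+ i * (lam * (dir_form a b m * dir_form a b (reverse m) *
     (nx (orbit a b z i) * slope (orbit a b z i.+2) +
      nx (orbit a b z i.+2) * - slope (orbit a b z i))))).
    by rewrite /u det2E !exprS; ring.
  by rewrite E (exprS _ i); field; rewrite l1 qm qrm.
apply: (winding_no_half_turn b0 ba _ _ k0 hper tz x0 (u := u)) => //.
- by rewrite lt_eqF.
- by rewrite gt_eqF.
- move=> i; set w := orbit a b z i; set w' := orbit a b z i.+1.
  have E := hyperbola_step_turn b0 ba (t i).
  (* The chord joins opposite arcs, so its vertical sense is determined by the arc on which it
     starts. *)
  have dy : 0 < (-1) ^+ i.+1 * diry w.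
    have c0 : 0 < 2 * normal_sq w * a / dir_form a b w.
      by rewrite !(mulr_gt0, invr_gt0) //; [exact: N|exact: q].
    rewrite -(pmulr_rgt0 _ c0).
    have -> : 2 * normal_sq w * a / dir_form a b w * ((-1) ^+ i.+1 * diry w) =
      (-1) ^+ i.+1 * ny w' + (-1) ^+ i * ny w.
      by rewrite /w' [orbit _ _ _ i.+1]/= ny_next exprS -/w; ring.
    by apply: addr_gt0; [exact: (y i.+1) | exact: (y i)].
  rewrite -(pmulr_rgt0 _ (q i)) -/w.
  have -> : dir_form a b w * det2 (u i) (u i.+1) =
     a * (2 * (slope w ^+ 2 + (a - b) * nx w ^+ 2)) * ((-1) ^+ i.+1 * diry w).
    transitivity (a * (-1) ^+ i.+1 * (dir_form a b w * (nx w * slope w' + nx w' * slope w))).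
      by rewrite /u det2E -/w -/w' (exprS _ i); ring.
    by rewrite E; ring.
  by rewrite mulr_gt0 // mulr_gt0 // mulr_gt0 //; apply: pos.
have [lt|ge] := ltrP (a * b - lam * (a - b)) 0; [right|left] => i.
  by have [p p0 ->] := double i; rewrite nmulr_rgt0.
by have [p p0 ->] := double i; rewrite nmulr_rlt0 // lt_def ge andbT.
Qed.

End Bounce.

Theorem proposition5p4 (R : realType) (a b lambda0 : R) (k : nat)
    (hb : 0 < b) (hab : b < a)
    (hlambda0 : 0 < lambda0 < b \/ b < lambda0 < a)
    (hk : (1 <= k)%N)
    (hper : forall P : nat -> R * R,
      billiard_trajectory a b P -> has_caustic a b lambda0 P ->
      periodic_trajectory P (4 * k) /\
      winding_numbers P (4 * k) (4 * k) (2 * k))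
    (p : {poly R}) (hp : corresponding_poly a b lambda0 (4 * k) p) :
  (lambda0 < b ->
    exists2 c : R, c != 0 &
      forall s : R,
        p.[s] = c * (chebyshev_poly R (2 * k)).[2 * a * b * s ^+ 2
                                            - 2 * (a + b) * s + 1]) /\
  (b < lambda0 ->
    exists2 c : R, c != 0 &
      forall s : R,
        (* in the original variable s this is
           (2 a^2 b s^2 - 2 a^2 s + a - b) / (a - b), equal to 1 at 0 and 1/b
           and to -1 at 1/a and 1/b - 1/a, as the Pell equation requires *)
        let t := 4 * b ^+ 2 * s in
        p.[s] = c * (chebyshev_poly R (2 * k)).[
          (a ^+ 2 * t ^+ 2 - 4 * a ^+ 2 * b * t + 8 * b ^+ 3 * (a - b))
            / (8 * b ^+ 3 * (a - b))]).
Proof.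
have a0 : 0 < a := lt_trans hb hab.
have a1 := lt0r_neq0 a0; have b1 := lt0r_neq0 hb.
have h1 : a - b != 0 by rewrite subr_eq0 gt_eqF.
split=> hl.
  have hl0 : 0 < lambda0 < b by case: hlambda0 => // /andP[/(lt_trans hl)]; rewrite ltxx.
  have lamE := ellipse_caustic_quarter hb hab hl0 hk hper.
  (* The quadratic is 1 at 0 and [lambda0^-1], and -1 at [a^-1] and [b^-1]; the last two values fix
     its leading coefficient. *)
  have [|||c c0 pc] := @corresponding_poly_chebyshev R a b lambda0 (2 * a * b)
    lambda0^-1 a^-1 b^-1 k p hk _ lamE _ _ hp.
  - by rewrite !mulf_neq0 // pnatr_eq0.
  - by field; rewrite a1 b1.
  - by ring.
  exists c => // s; rewrite pc lamE; congr (_ * _.[_]); field; exact/andP.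
have hl0 : b < lambda0 < a by case: hlambda0 => // /andP[_ /(lt_trans hl)]; rewrite ltxx.
have lamE := hyperbola_caustic_quarter hb hab hl0 hk hper.
(* Now [b^-1] is paired with 0, and [a^-1] with [lambda0^-1], because [b^-1] is the sum of the
   latter two. *)
have [||||c c0 pc] := @corresponding_poly_chebyshev R a b lambda0
  (2 * a ^+ 2 * b / (a - b)) b^-1 a^-1 lambda0^-1 k p hk _ _ _ _ hp.
- by rewrite !mulf_neq0 ?invr_eq0 ?expf_neq0 // pnatr_eq0.
- by rewrite lamE; ring.
- by rewrite lamE; field; rewrite a1 b1 h1.
- by ring.
exists c => // s t; rewrite pc /t; congr (_ * _.[_]); field; rewrite h1 b1; split.
Qed.
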